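(* Let $G$ be either an Eulerian undirected planar triangulation or an Eulerian oriented planar triangulation, with tripartition $I_1,I_2,I_3$. If there exists $i\in\{1,2,3\}$ such that $G-I_i$ has a CAI-partition, then $V(G)$ can be partitioned into two acyclic sets $A_1,A_2$. Moreover, $A_1$ and $A_2$ can be chosen such that $A_1$ induces a connected subgraph and $A_2$ induces a forest (in the underlying undirected graph) and contains $I_i$ for some $i\in\{1,2,3\}$.
   Context: An oriented graph is a directed graph without directed cycles of length $1$ or $2$. An undirected graph is Eulerian if it is connected and all degrees are even; an oriented graph is Eulerian if it is connected and every vertex has in-degree equal to out-degree. A planar triangulation is a (finite, simple) planar graph all of whose faces, including the outer face, are triangles; an oriented planar triangulation is an oriented graph whose underlying graph is a planar triangulation. An Eulerian (oriented) planar triangulation has a unique partition of its vertex set into three independent sets, called its tripartition. A vertex set of an undirected graph is acyclic if it induces a forest; a vertex set of a directed graph is acyclic if it induces a subdigraph without directed cycles. Connectedness and independence refer to the underlying undirected graph. A CAI-partition of an (oriented) graph $H$ is a partition $V(H)=\mathcal{A}\cup\mathcal{I}$ such that $\mathcal{A}$ is acyclic and induces a connected sub(di)graph, and $\mathcal{I}$ is an independent set. *)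

(* Defs.v *)
From HB Require Import structures.
From mathcomp Require Import all_boot all_order all_algebra.
From mathcomp Require Import all_classical all_reals all_analysis.
Import numFieldNormedType.Exports.
Set Implicit Arguments.
Unset Strict Implicit.
Unset Printing Implicit Defensive.
Import Order.TTheory GRing.Theory Num.Theory.

Section Graphs.
Variable T : finType.
Implicit Types (e d : rel T) (A J W : {set T}).

Definition simple_graph e := symmetric e /\ irreflexive e.

(* [d x y] means that there is an arc from x to y. *)
Definition oriented_graph d :=
  irreflexive d /\ (forall x y, d x y -> ~~ d y x).

Definition underlying d : rel T := [rel x y | d x y || d y x].

(* The subgraph induced by A is connected; the empty graph is not connected. *)
Definition induces_connected e A :=
  A != finset.set0 /\
  {in A &, forall x y, connect [rel u v | [&& u \in A, v \in A & e u v]] x y}.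

(* The length condition excludes the closed walks x, y, x along one edge, which
   [ucycle] accepts for a symmetric relation. *)
Definition induces_forest e A :=
  forall s : seq T, 2 < size s -> ucycle e s -> ~ {subset s <= A}.

Definition induces_acyclic_digraph d A :=
  forall s : seq T, 0 < size s -> ucycle d s -> ~ {subset s <= A}.

Definition independent e J := {in J &, forall x y, ~~ e x y}.

Definition two_partition W A J := A :|: J = W /\ [disjoint A & J].

(* CAI-partition of the subgraph induced by W. The edge relation e is that of
   the underlying undirected graph; [acyclic] is the notion of acyclic vertex
   set of the (directed or undirected) graph itself. *)
Definition CAI_partition e (acyclic : {set T} -> Prop) W A J :=
  [/\ two_partition W A J, acyclic A, induces_connected e A
    & independent e J].

Definition has_CAI_partition e (acyclic : {set T} -> Prop) W :=
  exists A J, CAI_partition e acyclic W A J.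

Definition eulerian e :=
  induces_connected e [set: T] /\ forall x, ~~ odd #|[set y | e x y]|.

Definition eulerian_oriented d :=
  induces_connected (underlying d) [set: T] /\
  forall x, #|[set y | d y x]| = #|[set y | d x y]|.

Definition tripartition e (I : 'I_3 -> {set T}) :=
  (forall x, exists! i, x \in I i) /\ (forall i, independent e (I i)).

End Graphs.

(* Plane graphs in the sense of Diestel's "Graph Theory", Section 4.2: edges are
   drawn as polygonal arcs, i.e. subsets of the plane that are finite unions of
   line segments and homeomorphic to [0, 1]. *)
Section PlaneGraphs.
Local Open Scope classical_set_scope.
Local Open Scope ring_scope.
Variables (R : realType) (T : finType).
Implicit Types (p q : R * R) (s : seq (R * R)) (e : rel T).

Definition segment p q : set (R * R) :=
  [set (1 - t) *: p + t *: q | t in `[0, 1]].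

(* The polygonal line through the points of p :: s. *)
Fixpoint polyline p s : set (R * R) :=
  if s is q :: s' then segment p q `|` polyline q s' else [set p].

(* The line does not meet itself: each segment meets the part of the line that
   follows it only at their common point. Immediate repetitions in p :: s are
   allowed: they do not change the set. *)
Fixpoint simple_polyline p s : Prop :=
  if s is q :: s' then
    segment p q `&` polyline q s' `<=` [set q] /\ simple_polyline q s'
  else True.

(* [bend x y] lists the intermediate corners of the arc drawn for the edge xy,
   from x to y. *)
Record drawing := Drawing {
  pos : T -> R * R;
  bend : T -> T -> seq (R * R)
}.

Definition corners (D : drawing) x y : seq (R * R) :=
  rcons (bend D x y) (pos D y).

Definition arc_of (D : drawing) x y : set (R * R) :=
  polyline (pos D x) (corners D x y).

Definition plane_drawing e (D : drawing) :=
  [/\ injective (pos D),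
      forall x y, e x y -> simple_polyline (pos D x) (corners D x y),
      forall x y, e x y -> arc_of D x y = arc_of D y x,
      forall x y z, e x y -> arc_of D x y (pos D z) -> z = x \/ z = y
    & forall x y u v, e x y -> e u v -> [set x; y]%SET != [set u; v]%SET ->
        arc_of D x y `&` arc_of D u v `<=` range (pos D)].

Definition carrier e (D : drawing) : set (R * R) :=
  range (pos D) `|` [set p | exists x y, e x y /\ arc_of D x y p].

Definition is_face e (D : drawing) (F : set (R * R)) :=
  exists2 p, (~` carrier e D) p & F = connected_component (~` carrier e D) p.

Definition frontier (F : set (R * R)) := closure F `\` interior F.

Definition bounded_by_triangle e (D : drawing) (F : set (R * R)) :=
  exists a b c, [/\ e a b, e b c, e c a &
    frontier F = arc_of D a b `|` arc_of D b c `|` arc_of D c a].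

(* The outer face is one of the faces F. *)
Definition planar_triangulation e :=
  simple_graph e /\
  exists2 D, plane_drawing e D &
    forall F, is_face e D F -> bounded_by_triangle e D F.

Definition oriented_planar_triangulation (d : rel T) :=
  oriented_graph d /\ planar_triangulation (underlying d).

End PlaneGraphs.

Arguments planar_triangulation R {T} e.
Arguments oriented_planar_triangulation R {T} d.

(* Main.v *)
Require Import Defs.
From mathcomp Require Import all_boot all_order all_algebra.
From mathcomp Require Import all_classical all_reals all_analysis.
From mathcomp Require Import ring lra.

(** Let A, J be a CAI-partition of G - I_i. Then A and the union of J and I_i
    are the required sets: all that has to be shown is that the latter, the
    complement of A, induces a forest.

    Suppose that it contains a cycle C. In the plane drawing C is a closed
    polygon avoiding A, and as A is connected, A lies on one side of C. Some face
    F lies on the other side, and so the triangle bounding F has no vertex in A.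
    But its three vertices are pairwise adjacent, so at most one of them is in
    the independent set I_i and at most one in the independent set J; the third
    one is in A, a contradiction. A forest in the underlying graph is acyclic for
    every orientation, which settles the oriented case at the same time.

    Only one half of the Jordan curve theorem is used, namely that C separates
    the plane. The sides are told apart by the parity of the number of edges of
    C that a horizontal ray meets ([crossing_parity]). This parity is locally
    constant off C ([crossing_parity_box]), hence constant on connected sets that
    avoid C ([crossing_parity_connected]), and both values occur
    ([crossing_parity_switch], [cycle_parity_switch]). The face F exists because
    the drawing, a finite union of segments, contains no nonempty open set
    ([carrier_avoided]). *)

Set Implicit Arguments.
Unset Strict Implicit.
Unset Printing Implicit Defensive.
Import Order.TTheory GRing.Theory Num.Theory numFieldNormedType.Exports.

(** * Segments and polygonal lines *)

Section Polylines.
Local Open Scope classical_set_scope.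
Local Open Scope ring_scope.
Variable R : realType.
Implicit Types (p q a b c : R * R) (s t : seq (R * R)).

Lemma segmentP a b q :
  segment a b q <-> exists2 l, 0 <= l <= 1 &
    q.1 = a.1 + l * (b.1 - a.1) /\ q.2 = a.2 + l * (b.2 - a.2).
Proof.
have E (l : R) :
    (1 - l) *: a + l *: b = (a.1 + l * (b.1 - a.1), a.2 + l * (b.2 - a.2)).
  rewrite (surjective_pairing (_ + _)); congr pair.
    transitivity ((1 - l) * a.1 + l * b.1); [by [] | ring].
  transitivity ((1 - l) * a.2 + l * b.2); [by [] | ring].
split=> [[l /=]|[l hl [h1 h2]]].
  by rewrite in_itv /= E => hl <-; exists l.
by exists l; rewrite /= ?in_itv // E -h1 -h2 -surjective_pairing.
Qed.

Lemma segment_left a b : segment a b a.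
Proof.
by apply/segmentP; exists 0; [rewrite lexx ler01 | rewrite !mul0r !addr0].
Qed.

Lemma segmentxx a : segment a a = [set a].
Proof.
apply/seteqP; split=> [q /segmentP[l _]|_ ->]; last exact: segment_left.
rewrite !subrr !mulr0 !addr0 /= => -[h1 h2].
by rewrite (surjective_pairing q) h1 h2 -surjective_pairing.
Qed.

Lemma polyline_head a s : polyline a s a.
Proof. by case: s => [|b s] //=; left; apply: segment_left. Qed.

Lemma polyline_last a s : polyline a s (last a s).
Proof. by elim: s a => //= b s IH a; right. Qed.

Lemma polyline_cat a s t :
  polyline a (s ++ t) = polyline a s `|` polyline (last a s) t.
Proof.
elim: s a => [|b s IH] a /=; last by rewrite IH setUA.
apply/esym/seteqP; split=> [q [->|]//|q]; [exact: polyline_head | by right].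
Qed.

Lemma polyline_dup a s : polyline a (a :: s) = polyline a s.
Proof.
rewrite /= segmentxx; apply/seteqP; split=> [q [->|]//|q]; last by right.
exact: polyline_head.
Qed.

(** * The ray-crossing parity of a polygonal line *)

(** The abscissa at which the line through a and b has height v; a junk value
    when the line is horizontal. *)
Definition edge_abscissa a b (v : R) : R :=
  a.1 + (v - a.2) / (b.2 - a.2) * (b.1 - a.1).

(** The horizontal ray from q to the right meets the edge ab. The lower end of
    an edge counts as part of it and the upper end does not, so that a ray
    through a corner is counted correctly and a horizontal edge never counts. *)
Definition crosses q a b : bool :=
  ((q.2 < a.2) (+) (q.2 < b.2)) && (q.1 < edge_abscissa a b q.2).

Fixpoint crossing_parity q a s : bool :=
  if s is b :: s' then crosses q a b (+) crossing_parity q b s' else false.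

Lemma crosses_dup q a : crosses q a a = false.
Proof. by rewrite /crosses addbb. Qed.

Lemma edge_abscissa_segment a b (v : R) : a.2 != b.2 ->
  Num.min a.2 b.2 <= v <= Num.max a.2 b.2 ->
  segment a b (edge_abscissa a b v, v).
Proof.
move=> ab hv; apply/segmentP; exists ((v - a.2) / (b.2 - a.2)) => /=; last first.
  by split=> //; rewrite divfK ?subrKC // subr_eq0 eq_sym.
move: ab hv; rewrite neq_lt => /orP[] ab.
  rewrite (min_l (ltW ab)) (max_r (ltW ab)) => /andP[h1 h2].
  have d0 : 0 < b.2 - a.2 by rewrite subr_gt0.
  by rewrite ler_pdivlMr // ler_pdivrMr // mul0r mul1r subr_ge0 h1 lerB.
rewrite (min_r (ltW ab)) (max_l (ltW ab)) => /andP[h1 h2].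
have d0 : b.2 - a.2 < 0 by rewrite subr_lt0.
by rewrite ler_ndivlMr // ler_ndivrMr // mul0r mul1r subr_le0 h2 lerB.
Qed.

Lemma straddle_between a b (v : R) : (v < a.2) (+) (v < b.2) ->
  a.2 != b.2 /\ Num.min a.2 b.2 <= v <= Num.max a.2 b.2.
Proof.
case: (ltP v a.2) => h1; case: (ltP v b.2) => h2 //= _.
  by rewrite gt_eqF ?(le_lt_trans h2) // ge_min h2 orbT le_max (ltW h1).
by rewrite lt_eqF ?(le_lt_trans h1) // ge_min h1 le_max (ltW h2) orbT.
Qed.

(** Moving horizontally, the ray loses or gains an edge only when the moving
    point traverses that edge. *)
Lemma crosses_horizontal a b (u u' v : R) : u <= u' ->
    (forall w, u <= w <= u' -> ~ segment a b (w, v)) ->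
  crosses (u, v) a b = crosses (u', v) a b.
Proof.
move=> uu' H; rewrite /crosses /=.
case E : (_ (+) _) => //=; have [ab hv] := straddle_between E.
have HH := H (edge_abscissa a b v).
case: (ltP u' _) => h; first by rewrite (le_lt_trans uu' h).
apply/negbTE/negP => h2; have := edge_abscissa_segment ab hv.
by apply: HH; rewrite (ltW h2).
Qed.

(** The points that lie to the right of the vertical segment with abscissa u
    between the heights v and v'. The range of heights is half-open to agree
    with [crosses]: a corner q counts when it is strictly above the ray at height
    v but not strictly above the ray at height v'. *)
Definition shadow (u v v' : R) q : bool := (u < q.1) && (v < q.2 <= v').

Lemma edge_abscissa_left a b : edge_abscissa a b a.2 = a.1.
Proof. by rewrite /edge_abscissa subrr !mul0r addr0. Qed.

Lemma edge_abscissa_right a b : a.2 != b.2 -> edge_abscissa a b b.2 = b.1.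
Proof.
by move=> ab; rewrite /edge_abscissa divff ?mul1r ?subrKC // subr_eq0 eq_sym.
Qed.

(** By the intermediate value property of the affine function
    [edge_abscissa a b]: an edge that runs on both sides of the vertical segment
    meets it. *)
Lemma edge_one_side a b (u v v' w w' : R) : a.2 != b.2 ->
    (forall z, v <= z <= v' -> ~ segment a b (u, z)) ->
    v <= w <= v' -> v <= w' <= v' ->
    Num.min a.2 b.2 <= w <= Num.max a.2 b.2 ->
    Num.min a.2 b.2 <= w' <= Num.max a.2 b.2 ->
  (u < edge_abscissa a b w) = (u < edge_abscissa a b w').
Proof.
move=> ab H.
wlog suff imp : w w' / v <= w <= v' -> v <= w' <= v' ->
    Num.min a.2 b.2 <= w <= Num.max a.2 b.2 ->
    Num.min a.2 b.2 <= w' <= Num.max a.2 b.2 ->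
    u < edge_abscissa a b w -> u < edge_abscissa a b w'.
  by move=> h1 h2 h3 h4; apply/idP/idP; apply: imp.
move=> /andP[h1 h1'] /andP[h2 h2'] /andP[h3 h3'] /andP[h4 h4'] lt_u.
rewrite ltNge; apply/negP => ge_u.
have d0 : 0 < edge_abscissa a b w - edge_abscissa a b w'.
  by rewrite subr_gt0; apply: le_lt_trans lt_u.
pose l := (u - edge_abscissa a b w') / (edge_abscissa a b w - edge_abscissa a b w').
have l0 : 0 <= l.
  by rewrite divr_ge0 ?subr_ge0 ?(ltW lt_u) ?(le_trans ge_u (ltW lt_u)).
have l1 : l <= 1 by rewrite ler_pdivrMr // mul1r lerB // ltW.
have convex (m M : R) : m <= w -> w <= M -> m <= w' -> w' <= M ->
    m <= w' + l * (w - w') <= M.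
  by move=> *; apply/andP; split; nra.
apply: (H (w' + l * (w - w'))); first exact: convex.
suff -> : u = edge_abscissa a b (w' + l * (w - w')).
  by apply: edge_abscissa_segment => //; apply: convex.
have -> : edge_abscissa a b (w' + l * (w - w')) =
    edge_abscissa a b w' + l * (edge_abscissa a b w - edge_abscissa a b w').
  by rewrite /edge_abscissa; ring.
by rewrite divfK ?subrKC // gt_eqF.
Qed.

(** The boundary of the shadow of a vertical segment consists of that segment
    and of two rays; an edge that misses the segment leaves and enters
    the shadow through the rays only. *)
Lemma crosses_vertical a b (u v v' : R) : v <= v' ->
    (forall w, v <= w <= v' -> ~ segment a b (u, w)) ->
  crosses (u, v) a b (+) crosses (u, v') a b
    = shadow u v v' a (+) shadow u v v' b.
Proof.
move=> vv' H; have [ab|ab] := eqVneq a.2 b.2.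
  rewrite /crosses /shadow /= ab !addbb /=.
  case hb : (v < b.2 <= v'); last by rewrite !andbF.
  rewrite !andbT; suff -> : (u < a.1) = (u < b.1) by rewrite addbb.
  have hb' : v <= b.2 <= v' by case/andP: hb => /ltW -> ->.
  have meet l : 0 <= l <= 1 -> u = a.1 + l * (b.1 - a.1) -> False.
    move=> hl hu; apply: (H _ hb'); apply/segmentP; exists l => //=.
    by rewrite ab subrr mulr0 addr0.
  case: (ltP u a.1) => ha; case: (ltP u b.1) => hc //; exfalso.
    have d0 : b.1 - a.1 < 0 by rewrite subr_lt0 (le_lt_trans hc).
    apply: (meet ((u - a.1) / (b.1 - a.1))); last by rewrite divfK ?lt_eqF ?subrKC.
    rewrite ler_ndivlMr // ler_ndivrMr // mul0r mul1r; lra.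
  have d0 : 0 < b.1 - a.1 by rewrite subr_gt0 (le_lt_trans ha).
  apply: (meet ((u - a.1) / (b.1 - a.1))); last by rewrite divfK ?gt_eqF ?subrKC.
  rewrite ler_pdivlMr // ler_pdivrMr // mul0r mul1r; lra.
have side := edge_one_side ab H.
have ea := edge_abscissa_left a b; have eb := edge_abscissa_right ab.
have ia : Num.min a.2 b.2 <= a.2 <= Num.max a.2 b.2.
  by rewrite ge_min lexx le_max lexx.
have ib : Num.min a.2 b.2 <= b.2 <= Num.max a.2 b.2.
  by rewrite ge_min lexx le_max lexx !orbT.
have iv : v <= v <= v' by rewrite lexx.
have iv' : v <= v' <= v' by rewrite vv' lexx.
have sv := @straddle_between a b v; have sv' := @straddle_between a b v'.
(* The cases are the positions of the ends of the edge relative to v and v'. In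
   each of them the rays and ends that count are at heights covered by [side],
   so that their sides agree, or nothing counts. *)
move: sv sv'; rewrite /crosses /shadow /=.
case: (ltP v a.2) => va; case: (ltP v b.2) => vb;
  case: (leP a.2 v') => va'; case: (leP b.2 v') => vb' //=;
  rewrite ?andbT ?andbF ?addbF ?addFb //=; try lra.
all: move=> sv sv'; try have [_ {}sv] := sv isT; try have [_ {}sv'] := sv' isT.
all: rewrite -?ea -?eb.
all: have xor0 (c d : bool) : c = d -> c (+) d = false by move=> ->; rewrite addbb.
all: try (apply: xor0); try (apply/esym/xor0).
all: by apply: side => //; apply/andP; split=> //; apply: ltW.
Qed.

Lemma crossing_parity_horizontal a s (u u' v : R) : u <= u' ->
    (forall w, u <= w <= u' -> ~ polyline a s (w, v)) ->
  crossing_parity (u, v) a s = crossing_parity (u', v) a s.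
Proof.
move=> uu'; elim: s a => //= b s IH a H.
rewrite (IH b) => [|w hw hs]; last by apply: (H w hw); right.
by congr (_ (+) _); apply: crosses_horizontal => // w hw hs; apply: (H w hw); left.
Qed.

Lemma crossing_parity_vertical a s (u v v' : R) : v <= v' ->
    (forall w, v <= w <= v' -> ~ polyline a s (u, w)) ->
  crossing_parity (u, v) a s (+) crossing_parity (u, v') a s
    = shadow u v v' a (+) shadow u v v' (last a s).
Proof.
move=> vv'; elim: s a => [|b s IH] a H /=; first by rewrite addbb.
rewrite addbACA crosses_vertical // => [|w hw hs]; last by apply: (H w hw); left.
rewrite IH => [|w hw hs]; last by apply: (H w hw); right.
by rewrite addbA -(addbA (shadow _ _ _ a)) addbb addbF.
Qed.

(** A point of the box is reached by a horizontal and a vertical move inside it.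
    The vertical one preserves the parity as well, because the two shadow terms
    of [crossing_parity_vertical] cancel for a closed line. *)
Lemma crossing_parity_box a s (e : R) q q' : last a s = a ->
    (forall z, `|z.1 - q.1| < e -> `|z.2 - q.2| < e -> ~ polyline a s z) ->
    `|q'.1 - q.1| < e -> `|q'.2 - q.2| < e ->
  crossing_parity q a s = crossing_parity q' a s.
Proof.
case: q q' => [u v] [u' v'] /= closed H; rewrite !ltr_norml => hu hv.
have Hbox w z : Num.min u u' <= w <= Num.max u u' ->
    Num.min v v' <= z <= Num.max v v' -> ~ polyline a s (w, z).
  move=> hw hz; apply: H => /=; rewrite ltr_norml.
    by case: (leP u u') hw => _; lra.
  by case: (leP v v') hz => _; lra.
transitivity (crossing_parity (u', v) a s).
  case: (leP u u') => uu'.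
    apply: crossing_parity_horizontal => // w hw.
    by apply: Hbox; [rewrite min_l ?max_r | rewrite ge_min le_max lexx].
  apply/esym/crossing_parity_horizontal; first exact: ltW.
  move=> w hw; apply: Hbox; last by rewrite ge_min le_max lexx.
  by rewrite min_r ?max_l // ltW.
have cancel x y : x (+) y = shadow u' (Num.min v v') (Num.max v v') a
    (+) shadow u' (Num.min v v') (Num.max v v') (last a s) -> x = y.
  by rewrite closed addbb; case: x; case: y.
have vertical : forall z, Num.min v v' <= z <= Num.max v v' ->
    ~ polyline a s (u', z).
  by move=> z; apply: Hbox; rewrite ge_min le_max lexx !orbT.
case: (leP v v') cancel vertical => vv' cancel vertical; apply: cancel.
  exact: crossing_parity_vertical.
by rewrite addbC; apply: crossing_parity_vertical => //; apply: ltW.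
Qed.

(** * The two sides of a closed polygonal line *)

Lemma closed_segment a b : closed (segment a b).
Proof.
apply: compact_closed; first exact: norm_hausdorff.
apply: continuous_compact; last exact: segment_compact.
apply: continuous_subspaceT => l; apply: cvgD; apply: cvgZr_tmp.
  by apply: cvgB; [exact: cvg_cst | exact: cvg_id].
exact: cvg_id.
Qed.

Lemma closed_polyline a s : closed (polyline a s).
Proof.
elim: s a => [|b s IH] a /=; last by apply: closedU => //; apply: closed_segment.
by rewrite -segmentxx; apply: closed_segment.
Qed.

Lemma box_nbhs p (U : set (R * R)) :
  nbhs p U <-> exists2 e : R, 0 < e &
    forall q, `|q.1 - p.1| < e -> `|q.2 - p.2| < e -> U q.
Proof.
split=> [/nbhs_ballP[e /= e0 sub]|[e e0 sub]].
  by exists e => // q h1 h2; apply: sub; split; rewrite /ball /= distrC.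
apply/nbhs_ballP; exists e => //= q [h1 h2].
by apply: sub; rewrite distrC; [exact: h1 | exact: h2].
Qed.

Lemma nbhs_box_disjoint p (K : set (R * R)) : closed K -> ~ K p ->
  exists2 e : R, 0 < e &
    forall q, `|q.1 - p.1| < e -> `|q.2 - p.2| < e -> ~ K q.
Proof. by move=> /closed_openC oK nKp; apply/box_nbhs; apply: open_nbhs_nbhs. Qed.

Definition midpoint a b : R * R := ((a.1 + b.1) / 2, (a.2 + b.2) / 2).

(** The parity changes when an edge is traversed away from the rest of the
    curve: at its midpoint, horizontally if the edge is not horizontal. In the
    remaining case the move is vertical; the edge has only one of its ends in
    the shadow of the move, and so has the rest of the curve. *)
Lemma crossing_parity_switch a b t : a != b -> last b t = a ->
    ~ polyline b t (midpoint a b) ->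
  exists q q', [/\ ~ polyline a (b :: t) q, ~ polyline a (b :: t) q'
    & crossing_parity q a (b :: t) != crossing_parity q' a (b :: t)].
Proof.
move=> ab closed nm.
have [e e0 He] := nbhs_box_disjoint (@closed_polyline b t) nm.
set m := midpoint a b in nm He.
have close (w c : R) : c - e / 2 <= w <= c + e / 2 -> `|w - c| < e.
  by rewrite ltr_norml; lra.
have self (c : R) : `|c - c| < e by rewrite subrr normr0.
have on_ab z : segment a b z -> exists l,
    z.1 - m.1 = (l - 1 / 2) * (b.1 - a.1) /\
    z.2 - m.2 = (l - 1 / 2) * (b.2 - a.2).
  by case/segmentP=> l _ [-> ->]; exists l; rewrite /m /=; split; field.
have [ab2|ab2] := eqVneq a.2 b.2.
  have ab1 : a.1 != b.1.
    apply: contra_neq ab => ab1.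
    by rewrite (surjective_pairing a) ab1 ab2 -surjective_pairing.
  have off z : z.2 != m.2 -> ~ segment a b z.
    move=> zm /on_ab[l [_]]; rewrite ab2 subrr mulr0 => /eqP.
    by rewrite subr_eq0 (negbTE zm).
  have Hv w : m.2 - e / 2 <= w <= m.2 + e / 2 -> ~ polyline b t (m.1, w).
    by move=> hw; apply: He; [exact: self | exact: close].
  have up : m.2 - e / 2 <= m.2 + e / 2 by lra.
  exists (m.1, m.2 - e / 2), (m.1, m.2 + e / 2); split.
  - case; first by apply: off => /=; rewrite lt_eqF //; lra.
    by apply: Hv; lra.
  - case; first by apply: off => /=; rewrite gt_eqF //; lra.
    by apply: Hv; lra.
  - have flat q : crossing_parity q a (b :: t) = crossing_parity q b t.
      by rewrite /= /crosses ab2 addbb.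
    have := crossing_parity_vertical up Hv.
    rewrite !flat closed => E.
    suff odd : shadow m.1 (m.2 - e / 2) (m.2 + e / 2) b
        (+) shadow m.1 (m.2 - e / 2) (m.2 + e / 2) a.
      by move: odd; rewrite -E; case: crossing_parity; case: crossing_parity.
    rewrite /shadow ab2 /m /midpoint /= ab2.
    have -> : (b.2 + b.2) / 2 - e / 2 < b.2 <= (b.2 + b.2) / 2 + e / 2 by lra.
    rewrite !andbT; move: ab1; rewrite neq_lt => /orP[] h.
      by case: ltP => h1; case: ltP => h2 //=; move: h h1 h2; clear; lra.
    by case: ltP => h1; case: ltP => h2 //=; move: h h1 h2; clear; lra.
have off z : z.1 != m.1 -> z.2 = m.2 -> ~ segment a b z.
  move=> zm zm2 /on_ab[l [E1 E2]]; move: E2 E1; rewrite zm2 subrr => /esym/eqP.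
  rewrite mulf_eq0 [b.2 - _ == 0]subr_eq0 eq_sym [b.2 == _]eq_sym.
  rewrite (negbTE ab2) orbF eq_sym.
  by move=> /eqP ->; rewrite mul0r => /eqP; rewrite subr_eq0 (negbTE zm).
have Hh w : m.1 - e / 2 <= w <= m.1 + e / 2 -> ~ polyline b t (w, m.2).
  by move=> hw; apply: He; [exact: close | exact: self].
have up : m.1 - e / 2 <= m.1 + e / 2 by lra.
exists (m.1 - e / 2, m.2), (m.1 + e / 2, m.2); split.
- case; first by apply: off => //=; rewrite lt_eqF //; lra.
  by apply: Hh; lra.
- case; first by apply: off => //=; rewrite gt_eqF //; lra.
  by apply: Hh; lra.
- rewrite /= (crossing_parity_horizontal up Hh) {1 2}/crosses /=.
  have -> : edge_abscissa a b m.2 = m.1.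
    rewrite /edge_abscissa /m /midpoint /=; field.
    by rewrite subr_eq0 eq_sym.
  have -> : (m.2 < a.2) (+) (m.2 < b.2).
    move: ab2; rewrite neq_lt /m /midpoint /= => /orP[] h.
      by case: ltP => h1; case: ltP => h2 //=; move: h h1 h2; clear; lra.
    by case: ltP => h1; case: ltP => h2 //=; move: h h1 h2; clear; lra.
  rewrite /=; have -> : m.1 - e / 2 < m.1 by lra.
  have -> : m.1 + e / 2 < m.1 = false by apply/negbTE; rewrite -leNgt; lra.
  by case: crossing_parity.
Qed.

Definition parity_region a s (o : bool) : set (R * R) :=
  [set q | ~ polyline a s q /\ crossing_parity q a s = o].

Lemma open_parity_region a s o : last a s = a -> open (parity_region a s o).
Proof.
move=> closed; rewrite openE => p [np po].
have [e e0 He] := nbhs_box_disjoint (@closed_polyline a s) np.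
apply/box_nbhs; exists e => // q h1 h2; split; first exact: He.
by rewrite -(crossing_parity_box closed He h1 h2).
Qed.

(** Both the part of K with the parity of p and the remaining part are
    relatively open. *)
Lemma crossing_parity_connected a s (K : set (R * R)) p q : last a s = a ->
    connected K -> (forall z, K z -> ~ polyline a s z) -> K p -> K q ->
  crossing_parity p a s = crossing_parity q a s.
Proof.
move=> closed Kc Koff Kp Kq; pose o := crossing_parity p a s.
suff /seteqP[_ /(_ q Kq)[_ [_ //]]] : K `&` parity_region a s o = K.
apply: Kc; first by exists p; split=> //; split=> //; apply: Koff.
  by exists (parity_region a s o) => //; apply: open_parity_region.
exists (~` parity_region a s (~~ o)).
  by apply: open_closedC; apply: open_parity_region.
apply/seteqP; split=> z [Kz].
  by case=> _ zo; split=> // -[_]; rewrite zo; case: (o).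
move=> zo; split=> //; split; first exact: Koff.
apply/eqP; apply/negP => /negP h; apply: zo; split; first exact: Koff.
by move: h; case: crossing_parity; case: (o).
Qed.

Lemma connected_segment a b : connected (segment a b).
Proof.
apply: connected_continuous_connected.
  by apply/connected_intervalP; apply: interval_is_interval.
apply: continuous_subspaceT => l; apply: cvgD; apply: cvgZr_tmp.
  by apply: cvgB; [exact: cvg_cst | exact: cvg_id].
exact: cvg_id.
Qed.

Lemma segment_right a b : segment a b b.
Proof.
by apply/segmentP; exists 1; [rewrite lexx ler01 | rewrite !mul1r !subrKC].
Qed.

Lemma crossing_parity_polyline a s b t : last a s = a ->
    (forall z, polyline b t z -> ~ polyline a s z) ->
  crossing_parity b a s = crossing_parity (last b t) a s.
Proof.
move=> closed; elim: t b => //= c t IH b off.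
rewrite -IH => [|z hz]; last by apply: off; right.
apply: (crossing_parity_connected closed (@connected_segment b c)).
- by move=> z hz; apply: off; left.
- exact: segment_left.
- exact: segment_right.
Qed.

(** A segment is contained in a line, so it cannot contain a point together
    with its two translates along the axes. *)
Lemma dense_segmentC a b : dense (~` segment a b).
Proof.
move=> U [p Up] oU.
have /box_nbhs[e e0 sub] : nbhs p U by apply: open_nbhs_nbhs.
apply: contrapT => /forallNP all_on.
have on q : U q -> segment a b q.
  by move=> Uq; apply: contrapT => nq; apply: (all_on q).
have small : `|p.1 + e / 2 - p.1| < e /\ `|p.2 + e / 2 - p.2| < e.
  by rewrite !(addrC _ (e / 2)) !addrK gtr0_norm; [split; lra | lra].
have self (c : R) : `|c - c| < e by rewrite subrr normr0.
have /segmentP[l _ [e1 e2]] := on _ Up.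
have /segmentP[l1 _ /= [e3 e4]] := on _ (sub (p.1 + e / 2, p.2) small.1 (self _)).
have /segmentP[l2 _ /= [e5 e6]] := on _ (sub (p.1, p.2 + e / 2) (self _) small.2).
have d1 : e / 2 = (l1 - l) * (b.1 - a.1) by rewrite mulrBl; lra.
have d2 : 0 = (l1 - l) * (b.2 - a.2) by rewrite mulrBl; lra.
have d3 : e / 2 = (l2 - l) * (b.2 - a.2) by rewrite mulrBl; lra.
have : e / 2 * (e / 2) = 0.
  transitivity ((l1 - l) * (b.2 - a.2) * ((l2 - l) * (b.1 - a.1))).
    by rewrite {1}d1 d3; ring.
  by rewrite -d2 mul0r.
by move/eqP; rewrite mulf_eq0 orbb gt_eqF //; lra.
Qed.

Lemma dense_polylineC a s : dense (~` polyline a s).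
Proof.
elim: s a => [|b s IH] a /=; first by rewrite -segmentxx; apply: dense_segmentC.
rewrite setCU; apply: denseI => //; last exact: dense_segmentC.
by apply: closed_openC; apply: closed_segment.
Qed.

Lemma open_polylines_avoided (U : set (R * R)) (L : seq ((R * R) * seq (R * R))) :
  open U -> U !=set0 ->
  exists2 p, U p & forall l, l \in L -> ~ polyline l.1 l.2 p.
Proof.
elim: L U => [|l L IH] U oU U0; first by case: U0 => p; exists p.
have [||p [Up lp] Lp] := IH (U `&` ~` polyline l.1 l.2).
- by apply: openI => //; apply: closed_openC; apply: closed_polyline.
- exact: dense_polylineC.
by exists p => // k; rewrite inE => /orP[/eqP ->|/Lp].
Qed.

(** Corners may repeat immediately, which changes neither the line nor its
    parities; so the repetitions at the start of s can be skipped, whatever line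
    u continues s. *)
Lemma polyline_first_step a s : last a s != a -> simple_polyline a s ->
  exists b t, [/\ a != b, segment a b `&` polyline b t `<=` [set b],
    last b t = last a s &
    forall u, polyline a (s ++ u) = polyline a (b :: t ++ u) /\
      forall q,
        crossing_parity q a (s ++ u) = crossing_parity q a (b :: t ++ u)].
Proof.
elim: s => [|c s IH] /=; first by rewrite eqxx.
have [->|ca] := eqVneq c a => ls [meet sim]; last first.
  by exists c, s; split; rewrite // eq_sym.
have [b [t [ab mt lt E]]] := IH ls sim.
exists b, t; split=> // u; have [E1 E2] := E u; split=> [|q].
  by rewrite -[LHS]/(polyline a (a :: s ++ u)) polyline_dup.
by rewrite crosses_dup /= E2.
Qed.

Lemma segment_midpoint a b : segment a b (midpoint a b).
Proof.
apply/segmentP; exists (1 / 2); first by apply/andP; split; lra.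
by rewrite /midpoint /=; split; field.
Qed.

Lemma midpoint_neq a b : a != b -> midpoint a b != a /\ midpoint a b != b.
Proof.
move=> ab; split; apply: contra_neq ab; rewrite /midpoint => E;
  rewrite [LHS]surjective_pairing [RHS]surjective_pairing -E /=;
  move: (congr1 fst E) (congr1 snd E) => /= h1 h2; congr pair; lra.
Qed.

End Polylines.

(** * Cycles of plane graphs *)

Section PlaneCycles.
Local Open Scope classical_set_scope.
Variables (R : realType) (T : finType).
Implicit Types (e : rel T) (D : drawing R T) (A : {set T}).

Fixpoint walk_corners D x (w : seq T) : seq (R * R) :=
  if w is y :: w' then corners D x y ++ walk_corners D y w' else [::].

Lemma last_corners D x y : last (pos D x) (corners D x y) = pos D y.
Proof. by rewrite last_rcons. Qed.

Lemma last_walk_corners D x w :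
  last (pos D x) (walk_corners D x w) = pos D (last x w).
Proof. by elim: w x => //= y w IH x; rewrite last_cat last_corners. Qed.

Lemma arc_of_left D x y : arc_of D x y (pos D x).
Proof. exact: polyline_head. Qed.

Lemma arc_of_right D x y : arc_of D x y (pos D y).
Proof. by rewrite -(last_corners D x y); apply: polyline_last. Qed.

Lemma walk_polyline e D x w q : path e x w ->
    polyline (pos D x) (walk_corners D x w) q ->
  q = pos D x \/
  exists u v, [/\ e u v, u \in x :: w, v \in x :: w & arc_of D u v q].
Proof.
elim: w x => [|y w IH] x /=; first by left.
case/andP=> exy ew; rewrite polyline_cat last_corners => -[hq|/(IH y ew)].
  by right; exists x, y; rewrite !inE !eqxx orbT.
case=> [->|[u [v [euv hu hv huv]]]].
  by right; exists x, y; rewrite !inE !eqxx orbT; split=> //; apply: arc_of_right.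
by right; exists u, v; rewrite inE hu orbT inE hv orbT.
Qed.

(** A cycle with more than two vertices passes through its first edge only
    once, which is where the parity can be seen to change. *)
Lemma cycle_other_edges e x y (s : seq T) : 0 < size s -> ucycle e (x :: y :: s) ->
  path [rel u v | e u v && ([set x; y]%SET != [set u; v]%SET)] y (rcons s x).
Proof.
move=> s0 /andP[/= /andP[_ cyc] /and3P[xys ys us]].
move: cyc; rewrite !rcons_path => /andP[es el]; apply/andP; split; last first.
  rewrite /= el /=; apply/eqP => /setP/(_ y); rewrite !inE eqxx orbT => /esym/orP[].
    move=> /eqP E; move: ys s0; rewrite {1}E; case: (s) => // z s' /=.
    by rewrite mem_last.
  by move=> /eqP E; move: xys; rewrite E inE eqxx.
apply: (@sub_in_path _ [pred z | z != x] e) es.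
  move=> u v /= /[!inE] ux vx euv; rewrite euv /=.
  apply/eqP => /setP/(_ x); rewrite !inE eqxx /= => /esym/orP[] /eqP E.
    by rewrite E eqxx in ux.
  by rewrite E eqxx in vx.
by apply/allP => z zs; rewrite inE; apply: contraNneq xys => <-.
Qed.

(** The half of the Jordan curve theorem that is needed: both parities occur off
    the closed polygon l that a cycle s traces. The switch takes place at the
    midpoint m of the first nondegenerate segment of the arc of the edge xy: the
    remainder of this arc avoids m because the arc is simple, and the arcs of
    the other edges can meet this arc only in vertices, none of which is m. *)
Lemma cycle_parity_switch e D (s : seq T) :
    plane_drawing e D -> 2 < size s -> ucycle e s ->
  exists a l, [/\ last a l = a,
    forall q, polyline a l q ->
      exists u v, [/\ e u v, u \in s, v \in s & arc_of D u v q]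
    & forall o, parity_region a l o !=set0].
Proof.
case: s => [|x [|y s]] // [pos_inj simple _ vertex cross] /= s0 cyc.
have others := cycle_other_edges s0 cyc.
have [/andP[exy _] /andP[xys _]] := andP cyc.
have xy : pos D y != pos D x.
  by apply: contraNneq xys => /pos_inj ->; rewrite inE eqxx.
have [||b [t [ab meet lt E]]] := @polyline_first_step R (pos D x) (corners D x y).
- by rewrite last_corners.
- exact: simple.
set w := rcons s x in others.
have [E1 E2] := E (walk_corners D y w).
have closed : last (pos D x) (walk_corners D x (y :: w)) = pos D x.
  by rewrite last_walk_corners /= last_rcons.
have [ma mb] := midpoint_neq ab; set m := midpoint _ _ in ma mb.
(* [E] for u = [::] is about the arc of the edge xy alone. *)
have mxy : arc_of D x y m.
  have [+ _] := E [::]; rewrite !cats0 /arc_of => ->.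
  by left; apply: segment_midpoint.
have m_last : pos D y = last b t by rewrite lt last_corners.
have not_pos z : m <> pos D z.
  move=> mz; have [zx|zy] := vertex x y z exy (ltac:(by rewrite -mz)).
    by move: ma; rewrite mz zx eqxx.
  have my : m = last b t by rewrite -m_last -zy.
  move: mb; rewrite [m == b](_ : _ = true) //; apply/eqP/meet; split.
    exact: segment_midpoint.
  by rewrite -/m my; apply: polyline_last.
exists (pos D x), (walk_corners D x (y :: w)); split=> //.
  move=> q /(@walk_polyline e) [||].
  - by move: cyc => /andP[].
  - move=> ->; exists x, y; rewrite !inE !eqxx orbT; split=> //.
    exact: arc_of_left.
  - case=> u [v [euv hu hv huv]]; exists u, v; split=> //.
      by move: hu; rewrite !inE mem_rcons inE; case/or4P => ->; rewrite ?orbT.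
    by move: hv; rewrite !inE mem_rcons inE; case/or4P => ->; rewrite ?orbT.
have lbt : last b (t ++ walk_corners D y w) = pos D x.
  by rewrite last_cat -m_last last_walk_corners last_rcons.
have [|q [q' [nq nq' qq']]] := crossing_parity_switch ab lbt.
  rewrite -/m polyline_cat -m_last => -[mt|].
    by move: mb; rewrite (meet m) ?eqxx //; split=> //; apply: segment_midpoint.
  move=> /(walk_polyline others) [|[u [v [/andP[euv ne] _ _ muv]]]].
    exact: not_pos.
  have [z _ mz] := cross x y u v exy euv ne m (conj mxy muv).
  by apply: (not_pos z).
move=> o.
set l := b :: t ++ walk_corners D y w in nq nq' qq'.
have [qo|qo] := eqVneq (crossing_parity q (pos D x) l) o.
  by exists q; split; [rewrite [polyline _ _]E1 | rewrite [LHS]E2].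
exists q'; split; first by rewrite [polyline _ _]E1.
rewrite [LHS]E2; move: qo qq'.
by case: o; case: (crossing_parity q _ _); case: (crossing_parity q' _ _).
Qed.

Lemma carrier_avoided e D (U : set (R * R)) :
  open U -> U !=set0 -> exists2 p, U p & ~ carrier e D p.
Proof.
move=> oU U0.
pose L := [seq (pos D u.1, corners D u.1 u.2) | u <- enum {: T * T}].
have [p Up Lp] := open_polylines_avoided L oU U0.
have off x y : ~ arc_of D x y p.
  apply: (Lp (pos D x, corners D x y)).
  by apply/mapP; exists (x, y); rewrite ?mem_enum.
(* [L] also contains loops and non-edges; the loops cover the vertices. *)
exists p => // -[[x _ xp]|[x [y [_ xyp]]]]; last exact: (off x y).
by apply: (off x x); rewrite -xp; apply: arc_of_left.
Qed.

(** Let C be a cycle that avoids A. The connected graph on A is drawn off C, so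
    that all its vertices have the same parity with respect to C. The region of
    the other parity is open and nonempty, so it meets a face F; as F is
    connected and avoids C, it is contained in this region. But F has a vertex
    of A on its frontier, and the region of the parity of A is a neighbourhood
    of this vertex that F does not meet. *)
Lemma forest_off_connected_dominating e D A :
    plane_drawing e D ->
    (forall F, is_face e D F -> bounded_by_triangle e D F) ->
    induces_connected e A ->
    (forall a b c, e a b -> e b c -> e c a -> [|| a \in A, b \in A | c \in A]) ->
  induces_forest e (~: A)%SET.
Proof.
move=> draw faces [A0 Aconn] dominating s s3 cyc sA.
have [a [l [closed on_cycle both]]] := cycle_parity_switch draw s3 cyc.
have [_ _ _ vertex cross] := draw.
have nA u : u \in s -> u \notin A by move=> /sA; rewrite inE.
have Aoff x : x \in A -> ~ polyline a l (pos D x).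
  move=> xA /on_cycle[u [v [euv us vs h]]].
  by case: (vertex u v x euv h) xA => ->; apply/negP; apply: nA.
have edge_off x y z : x \in A -> y \in A -> e x y -> arc_of D x y z ->
    ~ polyline a l z.
  move=> xA yA exy xyz /on_cycle[u [v [euv us vs uvz]]].
  have ne : [set x; y]%SET != [set u; v]%SET.
    apply/eqP => /setP/(_ x); rewrite !inE eqxx /= => /esym/orP[] /eqP E.
      by move: (nA u us); rewrite -E xA.
    by move: (nA v vs); rewrite -E xA.
  have [t _ tz] := cross x y u v exy euv ne z (conj xyz uvz).
  have tA : t \in A by move: xyz; rewrite -tz => /(vertex x y t exy)[] ->.
  by move: uvz; rewrite -tz => /(vertex u v t euv)[] tE;
    move: tA; rewrite tE; apply/negP; apply: nA.
pose parity x := crossing_parity (pos D x) a l.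
have parity_edge x y : x \in A -> y \in A -> e x y -> parity x = parity y.
  move=> xA yA exy; rewrite /parity -(last_corners D x y).
  apply: crossing_parity_polyline closed _ => z; exact: edge_off.
have parity_path x p : path [rel u v | [&& u \in A, v \in A & e u v]] x p ->
    parity x = parity (last x p).
  elim: p x => //= y p IH x /andP[/and3P[xA yA exy] /IH <-].
  exact: parity_edge.
have parity_A x y : x \in A -> y \in A -> parity x = parity y.
  by move=> xA yA; have /connectP[p /parity_path -> ->] := Aconn x y xA yA.
have [x0 x0A] := set0Pn _ A0.
have oV := open_parity_region (o := ~~ parity x0) closed.
have [p Vp pfree] := carrier_avoided e D oV (both _).
pose F := connected_component (~` carrier e D) p.
have F_face : is_face e D F by exists p.
have Foff z : F z -> ~ polyline a l z.
  move=> /(@connected_component_sub _ _ _ _) zfree /on_cycle[u [v [euv _ _ uvz]]].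
  by apply: zfree; right; exists u, v.
have FV z : F z -> crossing_parity z a l = ~~ parity x0.
  move=> Fz; have [_ <-] := Vp.
  apply: (crossing_parity_connected closed _ Foff Fz).
    exact: component_connected.
  exact: connected_component_refl.
have [u [v [w [euv evw ewu frF]]]] := faces F F_face.
have [y yA yF] : exists2 y, y \in A & frontier F (pos D y).
  case/or3P: (dominating u v w euv evw ewu) => yA;
    [exists u|exists v|exists w] => //; rewrite frF.
  - by left; left; apply: arc_of_left.
  - by left; right; apply: arc_of_left.
  - by right; apply: arc_of_left.
(* The frontier is contained in the closure. *)
have [/(_ (parity_region a l (parity x0)))[]] := yF.
  apply: open_nbhs_nbhs; split; first exact: open_parity_region.
  by split; [apply: Aoff | apply: parity_A].
by move=> z [/FV Ez [_]]; rewrite Ez; case: (parity x0).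
Qed.

End PlaneCycles.

(** A cycle of length one or two is excluded by the orientation, a longer one
    is a cycle of the underlying graph. *)
Lemma forest_acyclic_digraph (T : finType) (d : rel T) (A : {set T}) :
  oriented_graph d -> induces_forest (underlying d) A ->
  induces_acyclic_digraph d A.
Proof.
case=> irr asym forest [|x [|y [|z s]]] // _ /andP[cyc us].
- by move: cyc; rewrite /= irr.
- by move: cyc => /=; rewrite andbT => /andP[/asym/negP].
apply: forest => //; apply/andP; split=> //.
by apply: sub_cycle cyc => u v duv; rewrite /underlying /= duv.
Qed.

(** A meets every triangle of the graph, since at most one vertex of a triangle
    is in I and at most one in J; so [forest_off_connected_dominating] applies
    to A. *)
Lemma CAI_partition_complement_forest (R : realType) (T : finType) (e : rel T)
    (acyclic : {set T} -> Prop) (I A J : {set T}) :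
  planar_triangulation R e -> independent e I ->
  CAI_partition e acyclic (~: I) A J ->
  two_partition [set: T] A (J :|: I) /\ induces_forest e (J :|: I).
Proof.
case=> [[sym _] [D draw faces]] indI [[AJ dAJ] _ conn indJ].
have AE : (J :|: I)%SET = (~: A)%SET.
  apply/setP => z; move/setP/(_ z): AJ; have := @disjointFr _ _ _ z dAJ.
  rewrite !inE; case: (z \in A) => [/(_ isT) ->|_] /=; first by case: (z \in I).
  by case: (z \in J); case: (z \in I).
rewrite AE; split.
  by split; [rewrite finset.setUCr | rewrite -setI_eq0 finset.setICr].
apply: forest_off_connected_dominating draw faces conn _ => a b c eab ebc eca.
have eac : e a c by rewrite sym.
apply/negPn/negP; rewrite !negb_or => /and3P[].
rewrite -!finset.in_setC -AE !inE.
have nI x y : e x y -> ~~ ((x \in I) && (y \in I)).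
  by move=> exy; apply/negP => /andP[xI yI]; move: (indI x y xI yI); rewrite exy.
have nJ x y : e x y -> ~~ ((x \in J) && (y \in J)).
  by move=> exy; apply/negP => /andP[xJ yJ]; move: (indJ x y xJ yJ); rewrite exy.
move: (nI a b eab) (nI b c ebc) (nI a c eac) (nJ a b eab) (nJ b c ebc) (nJ a c eac).
by do 6![case: (_ \in _) => //=].
Qed.

Theorem mainTheorem5 (R : realType) (T : finType) :
  (forall (e : rel T) (I : 'I_3 -> {set T}),
     planar_triangulation R e -> eulerian e -> tripartition e I ->
     (exists i, has_CAI_partition e (induces_forest e) (~: I i)%SET) ->
     exists A1 A2 : {set T},
       two_partition [set: T]%SET A1 A2 /\
       induces_forest e A1 /\ induces_forest e A2 /\
       induces_connected e A1 /\
       exists i, I i \subset A2) /\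
  (forall (d : rel T) (I : 'I_3 -> {set T}),
     oriented_planar_triangulation R d -> eulerian_oriented d ->
     tripartition (underlying d) I ->
     (exists i, has_CAI_partition (underlying d) (induces_acyclic_digraph d)
                  (~: I i)%SET) ->
     exists A1 A2 : {set T},
       two_partition [set: T]%SET A1 A2 /\
       induces_acyclic_digraph d A1 /\ induces_acyclic_digraph d A2 /\
       induces_connected (underlying d) A1 /\
       induces_forest (underlying d) A2 /\
       exists i, I i \subset A2).
Proof.
split=> [e I tri _ [_ ind]|d I [ori tri] _ [_ ind]] [i [A [J cai]]];
  have [part forest] := CAI_partition_complement_forest tri (ind i) cai;
  have [_ acyclicA connA _] := cai;
  exists A, (J :|: I i)%SET.
  by do ![split=> //]; exists i; apply: finset.subsetUr.
do ![split=> //]; first exact: forest_acyclic_digraph.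
by exists i; apply: finset.subsetUr.
Qed.
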